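(* Let $m$ be a positive integer. For any Ferrers board $B=(b_1,\dots,b_n)$, $$ \sum_{k=0}^n f_{k,m}(B)\, x\downarrow_{n-k,m} = \prod_{j=1}^n (x+b_j-(j-1)m). $$
   Context: A Ferrers board $B=(b_1,\dots,b_n)$ ($0\le b_1\le\dots\le b_n$ integers) is the set of the $b_j$ lowest cells of column $j$ in the first-quadrant grid of unit cells. A file placement on $B$ is a subset $F\subseteq B$ with no two cells (rooks) in the same column (several rooks may share a row). For $x$ and $n\ge0$, $x\downarrow_{n,m}=x(x-m)\cdots(x-(n-1)m)$, with $x\downarrow_{0,m}=1$. For a file placement $F$, let $t$ be the largest row index of $B$ and $y_i$ the number of rooks of $F$ in row $i$; the $m$-weight is $\mathrm{wt}_m F=\prod_{i=1}^t 1\downarrow_{y_i,m}$. Then $f_{k,m}(B)=\sum_F \mathrm{wt}_m F$, summed over file placements $F\subseteq B$ with $k$ rooks. *)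

(* Defs.v *)
From mathcomp Require Import all_boot all_order all_algebra.

Set Implicit Arguments.
Unset Strict Implicit.
Unset Printing Implicit Defensive.

Import GRing.Theory.
Local Open Scope ring_scope.

(* Falling factorial with step m: n factors, the last one x - (n-1)m. *)
Definition mfalling (R : comNzRingType) (x : R) (n m : nat) : R :=
  \prod_(i < n) (x - (i * m)%:R).

(* A Ferrers board is given by its column heights b, weakly increasing from
   left to right; the empty board (n = 0, or all heights 0) is allowed. *)
Definition is_ferrers (n : nat) (b : n.-tuple nat) : bool := sorted leq b.

(* The number of rows (the t of the m-weight, when rows start at 1), written as a
   maximum, rather than as the last height, to cover n = 0. *)
Definition nrows (n : nat) (b : n.-tuple nat) : nat := \max_(j < n) tnth b j.

(* Cells are pairs (column, row) in the bounding rectangle of the board;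
   both coordinates are numbered from 0. *)
Definition cell (n : nat) (b : n.-tuple nat) : finType :=
  ('I_n * 'I_(nrows b))%type.

Definition board (n : nat) (b : n.-tuple nat) : {set cell b} :=
  [set c : cell b | c.2 < tnth b c.1]%N.

Definition file_placement (n : nat) (b : n.-tuple nat) (F : {set cell b})
  : bool :=
  (F \subset board b) &&
  [forall c in F, forall d in F, (c.1 == d.1) ==> (c == d)].

Definition row_rooks (n : nat) (b : n.-tuple nat) (F : {set cell b})
  (i : 'I_(nrows b)) : nat :=
  #|[set c in F | c.2 == i]|.

Definition mweight (m n : nat) (b : n.-tuple nat) (F : {set cell b}) : int :=
  \prod_(i < nrows b) mfalling 1 (row_rooks F i) m.

Definition mfile_number (k m n : nat) (b : n.-tuple nat) : int :=
  \sum_(F : {set cell b} | file_placement F && (#|F| == k)) mweight m F.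

(* Main.v *)
(** Cut the board after its first [p] columns and let [G] be a file placement
    with [k] rooks there.  Adding a rook to column [p] in row [i] multiplies
    the weight of [G] by [1 - y_i m].  As the column heights increase, all the
    rooks of [G] lie in the [b_p] rows that column [p] meets, so these factors
    sum to [b_p - k m].  Hence the placements extending [G], column [p] being
    left empty or not, contribute
    [wt G * (x falling (p - k)) * ((x - (p - k) m) + (b_p - k m))], where the
    last factor [x + b_p - p m] does not depend on [G]. *)
Require Import Defs.
From mathcomp Require Import all_boot all_order all_algebra.
From mathcomp Require Import ring.

Import GRing.Theory.
Local Open Scope ring_scope.

Lemma mfallingS (R : comNzRingType) (x : R) (n m : nat) :
  mfalling x n.+1 m = mfalling x n m * (x - (n * m)%:R).
Proof. by rewrite /mfalling big_ord_recr. Qed.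

Section Placements.

Variables (n : nat) (b : n.-tuple nat).
Implicit Types (F G : {set cell b}) (c d : cell b).

(** Truncating the board by a predicate, with cells kept in the full [cell b], lets the induction on
    [p] use one type and one [mweight]; rows without rooks contribute the factor 1. *)
Definition placement_before (p : nat) (F : {set cell b}) : bool :=
  file_placement F && [forall c in F, (c.1 < p)%N].

Lemma placement_beforeP p F :
  reflect [/\ forall c, c \in F -> (c.2 < tnth b c.1)%N,
              forall c d, c \in F -> d \in F -> c.1 = d.1 -> c = d
            & forall c, c \in F -> (c.1 < p)%N]
          (placement_before p F).
Proof.
apply: (iffP idP) => [/andP[/andP[/subsetP sFB /forall_inP injF] /forall_inP ltp]|].
  split=> // [c /sFB|c d cF dF e]; first by rewrite inE.
  by apply/eqP; move/forall_inP: (injF c cF) => /(_ d dF); rewrite e eqxx.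
case=> sFB injF ltp; apply/andP; split; last exact/forall_inP.
apply/andP; split; first by apply/subsetP => c /sFB; rewrite inE.
apply/forall_inP => c cF; apply/forall_inP => d dF.
by apply/implyP => /eqP e; apply/eqP; apply: injF.
Qed.

Lemma placement_before_size F : placement_before n F = file_placement F.
Proof.
rewrite /placement_before; case: (file_placement F) => //=.
by apply/forall_inP => c _; apply: ltn_ord.
Qed.

Lemma placement_before0 F : placement_before 0 F = (F == set0).
Proof.
apply/placement_beforeP/eqP => [[_ _ ltp]|->].
  by apply/setP => c; rewrite inE; apply/negbTE/negP => /ltp.
by split=> [c|c d|c]; rewrite inE.
Qed.

Lemma card_ord_lt (k l : nat) : (k <= l)%N -> #|[set j : 'I_l | (j < k)%N]| = k.
Proof.
move=> le_kl; rewrite -sum1_card (eq_bigl (fun j : 'I_l => (j < k)%N)).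
  by rewrite -(big_ord_widen l (fun=> 1%N)) // sum1_card card_ord.
by move=> j; rewrite inE.
Qed.

(** Projection to columns is injective on a placement. The bound makes the natural-number
    subtraction [p - #|F|] a true difference. *)
Lemma leq_card_placement p F :
  (p <= n)%N -> placement_before p F -> (#|F| <= p)%N.
Proof.
move=> le_pn /placement_beforeP[_ injF ltp].
rewrite -[leqRHS](card_ord_lt _ _ le_pn).
rewrite -(card_in_imset (f := fun c : cell b => c.1)) => [|c d cF dF]; last first.
  exact: injF.
by apply/subset_leq_card/subsetP => _ /imsetP[c cF ->]; rewrite inE ltp.
Qed.

Lemma placement_beforeS_empty (j : 'I_n) F :
  placement_before j.+1 F && [forall i, (j, i) \notin F] = placement_before j F.
Proof.
apply/andP/idP => [[/placement_beforeP[sFB injF ltp] /forallP jF]|].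
  apply/placement_beforeP; split=> // c cF.
  move: (ltp c cF); rewrite ltnS leq_eqVlt => /predU1P[/val_inj e|//].
  by move: (jF c.2); rewrite -e -surjective_pairing cF.
case/placement_beforeP=> sFB injF ltp; split.
  by apply/placement_beforeP; split=> // c /ltp /ltnW.
by apply/forallP => i; apply/negP => /ltp /=; rewrite ltnn.
Qed.

Lemma placement_before_notin (j : 'I_n) i G :
  placement_before j G -> (j, i) \notin G.
Proof. by case/placement_beforeP=> _ _ ltp; apply/negP => /ltp /=; rewrite ltnn. Qed.

(** The left side is the condition produced by reindexing along [G |-> (j, i) |: G] with inverse
    [F |-> F :\ (j, i)]; its last conjunct says that [(j, i)] is not in [G]. *)
Lemma placement_beforeS_setU1 (j : 'I_n) i G :
  [&& placement_before j.+1 ((j, i) |: G), (j, i) \in (j, i) |: G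
     & ((j, i) |: G) :\ (j, i) == G]
  = (i < tnth b j)%N && placement_before j G.
Proof.
rewrite setU11 /=; apply/andP/andP.
  case=> /placement_beforeP[sFB injF ltp] /eqP defG.
  have jG : (j, i) \notin G by rewrite -defG !inE eqxx.
  split; first by have := sFB (j, i); rewrite setU11 /=; apply.
  apply/placement_beforeP; split=> [c cG|c d cG dG|c cG].
  - by apply: sFB; rewrite inE cG orbT.
  - by apply: injF; rewrite inE ?cG ?dG orbT.
  have cF : c \in (j, i) |: G by rewrite inE cG orbT.
  move: (ltp c cF); rewrite ltnS leq_eqVlt => /predU1P[/val_inj e|//].
  by rewrite -(injF c (j, i) cF (setU11 _ _) e) cG in jG.
case=> lt_ib plG; split; last first.
  by rewrite setU1K // placement_before_notin.
case/placement_beforeP: plG => sGB injG ltp.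
have neq_j c : c \in G -> c.1 <> j by move=> /ltp + e; rewrite e ltnn.
apply/placement_beforeP; split=> [c|c d|c].
- by case/setU1P=> [->//|/sGB].
- case/setU1P=> [->|cG] /setU1P[->|dG] //= e; last exact: injG.
    by case: (neq_j d dG).
  by case: (neq_j c cG).
by case/setU1P=> [->//|/ltp /ltnW].
Qed.

Lemma sum_placement_beforeS (V : nmodType) (j : 'I_n) (g : {set cell b} -> V) :
  \sum_(F | placement_before j.+1 F) g F
  = \sum_(G | placement_before j G)
      (g G + \sum_(i < nrows b | (i < tnth b j)%N) g ((j, i) |: G)).
Proof.
rewrite big_split /= (bigID (fun F => [forall i, (j, i) \notin F])) /=.
congr (_ + _); first by apply: eq_bigl => F; apply: placement_beforeS_empty.
(* The inner sum is empty if column [j] is, and otherwise has a single term, the row of the only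
   rook there. *)
transitivity (\sum_(F | placement_before j.+1 F) \sum_(i | (j, i) \in F) g F).
  rewrite [RHS](bigID (fun F => [forall i, (j, i) \notin F])) /=.
  rewrite [X in _ = X + _]big1 ?add0r => [|F /andP[_ /forallP jF]]; last first.
    by rewrite big_pred0 // => i; apply/negbTE.
  apply: eq_bigr => F /andP[/placement_beforeP[_ injF _]].
  rewrite negb_forall => /existsP[i]; rewrite negbK => iF.
  rewrite (big_pred1 i) // => k.
  apply/idP/eqP => [kF|->//].
  by case: (injF _ _ kF iF erefl).
rewrite (exchange_big_dep xpredT) //=.
rewrite [RHS](exchange_big_dep (fun i : 'I_(nrows b) => (i < tnth b j)%N)) //=.
(* Rows not below the height of column [j] give 0 on both sides. *)
rewrite [RHS]big_mkcond /=; apply: eq_bigr => i _.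
rewrite (reindex_onto (fun G => (j, i) |: G) (fun F => F :\ (j, i))) /=; last first.
  by move=> F /andP[_ iF]; apply: setD1K.
under eq_bigl do rewrite -andbA placement_beforeS_setU1.
case: (i < tnth b j)%N => /=; last by rewrite big_pred0_eq.
by apply: eq_bigl => G; rewrite andbT.
Qed.

Lemma row_rooks_setU1 c G (i : 'I_(nrows b)) :
  c \notin G -> row_rooks (c |: G) i = ((c.2 == i) + row_rooks G i)%N.
Proof.
move=> cG; rewrite /row_rooks; case: eqP => [e|ne].
  (* The summand 1 is put in the shape that [cardsU1] expects. *)
  rewrite -[RHS]/(true + _)%N -(_ : c \notin [set d in G | d.2 == i] = true).
    rewrite -cardsU1; apply: eq_card => d; rewrite !inE andb_orl.
    by case: eqP => //= ->; rewrite e eqxx.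
  by rewrite inE negb_and cG.
apply: eq_card => d; rewrite !inE andb_orl.
by case: eqP => //= ->; case: eqP ne.
Qed.

(** Only row [c.2] changes: its falling factorial gains one factor. *)
Lemma mweight_setU1 m c G : c \notin G ->
  mweight m (c |: G) = mweight m G * (1 - (row_rooks G c.2 * m)%:R).
Proof.
move=> cG; rewrite /mweight (bigD1 c.2) //= [in RHS](bigD1 c.2) //=.
rewrite row_rooks_setU1 // eqxx add1n mfallingS mulrAC; congr (_ * _ * _).
by apply: eq_bigr => i /negbTE ne; rewrite row_rooks_setU1 // eq_sym ne.
Qed.

Lemma mweight0 m : mweight m (set0 : {set cell b}) = 1.
Proof.
apply: big1 => i _; rewrite /row_rooks (_ : [set c in set0 | _] = set0).
  by rewrite cards0 /mfalling big_ord0.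
by apply/setP => c; rewrite !inE.
Qed.

Hypothesis hb : is_ferrers b.

Lemma ferrers_leq (i j : 'I_n) : (i <= j)%N -> (tnth b i <= tnth b j)%N.
Proof.
move=> le_ij; rewrite !(tnth_nth 0%N).
by apply: (sorted_leq_nth leq_trans leqnn 0%N hb) => //; rewrite inE size_tuple.
Qed.

(** Here the Ferrers shape enters: a rook in an earlier column lies below that column's height,
    hence below the height of column [j], so the restricted sum misses no rook. *)
Lemma sum_row_rooks (j : 'I_n) G : placement_before j G ->
  (\sum_(i < nrows b | i < tnth b j) row_rooks G i)%N = #|G|.
Proof.
case/placement_beforeP=> sGB _ ltp; rewrite -sum1_card.
rewrite (partition_big (fun c : cell b => c.2)
           (fun i : 'I_(nrows b) => (i < tnth b j)%N)) /=; last first.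
  by move=> c cG; apply: leq_trans (sGB c cG) (ferrers_leq _ _ (ltnW (ltp c cG))).
apply: eq_bigr => i _; rewrite /row_rooks -sum1_card.
by apply: eq_bigl => c; rewrite inE.
Qed.

Lemma sum_mweight_setU1 m (j : 'I_n) G : placement_before j G ->
  \sum_(i < nrows b | (i < tnth b j)%N) mweight m ((j, i) |: G)
  = mweight m G * ((tnth b j)%:R - (#|G| * m)%:R).
Proof.
move=> plG.
under eq_bigr do rewrite mweight_setU1 ?placement_before_notin //.
rewrite -mulr_sumr sumrB -natr_sum -big_distrl /= sum_row_rooks //.
(* Exactly [tnth b j] rows are counted, since this height is at most the maximum [nrows b]. *)
rewrite -(big_ord_widen _ (fun=> 1)) ?sumr_const ?card_ord //.
exact: (leq_bigmax_cond (F := tnth b)).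
Qed.

Lemma sum_placement_before m (R : comNzRingType) (x : R) p : (p <= n)%N ->
  \sum_(F | placement_before p F) (mweight m F)%:~R * mfalling x (p - #|F|) m
  = \prod_(j < n | (j < p)%N) (x + (tnth b j)%:R - (j * m)%:R).
Proof.
elim: p => [_|p IHp lt_pn].
  rewrite (big_pred1 set0) => [|F]; last exact: placement_before0.
  by rewrite mweight0 mul1r cards0 /mfalling big_ord0 big_pred0.
pose j := Ordinal lt_pn; rewrite (sum_placement_beforeS _ j).
rewrite [RHS](bigD1 j) //= [X in _ * X](eq_bigl (fun k : 'I_n => (k < p)%N)).
  rewrite -IHp ?(ltnW lt_pn) // mulr_sumr; apply: eq_bigr => G plG.
  have le_Gp : (#|G| <= p)%N by apply: leq_card_placement plG; apply: ltnW.
  (* With column [j] empty, one more factor of the falling factorial of [x] appears; a rook in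
     column [j] leaves [p - #|G|] factors. *)
  rewrite subSn // mfallingS.
  under eq_bigr do rewrite cardsU1 (placement_before_notin j) // subSS.
  rewrite -mulr_suml -rmorph_sum /= sum_mweight_setU1 //.
  (* Once the subtraction is moved into [R], the two multiples of [#|G| * m] cancel. *)
  rewrite intrM intrB !natz -!pmulrn mulnBl natrB ?leq_mul2r ?le_Gp ?orbT //.
  by ring.
by move=> k; rewrite ltnS -val_eqE /= ltn_neqAle andbC.
Qed.

End Placements.

Theorem theorem6p1 (m : nat) (hm : (0 < m)%N) (n : nat) (b : n.-tuple nat)
    (hb : is_ferrers b) (R : comNzRingType) (x : R) :
  \sum_(k < n.+1) (mfile_number k m b)%:~R * mfalling x (n - k) m
  = \prod_(j < n) (x + (tnth b j)%:R - (j * m)%:R).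
Proof.
transitivity (\sum_(F : {set cell b} | placement_before n b n F)
                (mweight m F)%:~R * mfalling x (n - #|F|) m).
  (* Placements are grouped by number of rooks; [inord] keeps this number, as it is at most [n]. *)
  rewrite (partition_big (fun F : {set cell b} => inord #|F| : 'I_n.+1) xpredT) //=.
  apply: eq_bigr => k _; rewrite /mfile_number rmorph_sum mulr_suml /=.
  apply: eq_big => [F|F /andP[_ /eqP->] //].
  rewrite placement_before_size; have [plF|//] := boolP (file_placement F).
  rewrite -val_eqE /= inordK // ltnS.
  by apply: leq_card_placement; rewrite ?placement_before_size.
rewrite sum_placement_before //.
by apply: eq_bigl => j; rewrite ltn_ord.
Qed.
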